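(* Let $0\le t\le1$, $0\le p\le1$, and $t_n=t\sqrt{\frac{p(1-p)}{n}}$. Consider the following three expressions, used as upper bounds for $\mathbf{Pr}(|\eta_n|>t)$: $$\exp\{-2\varepsilon^2n\},\qquad \exp\left\{-\frac{2\varepsilon^2n}{1+\varepsilon^2}\right\},\qquad \exp\left\{\varepsilon\cdot\varphi(n,\varepsilon)-\frac{2\varepsilon^2n}{1+\varepsilon^2}\right\},$$ each evaluated at $\varepsilon=t_n$. They are asymptotically equivalent: as $n\to\infty$ each of them converges to $$\alpha\exp\{-2t^2p(1-p)\}\quad\text{with }\alpha=1.$$
   Context: $X_1,X_2,\dots$ are independent identically distributed with $\mathbf{Pr}(X_i=1)=p$, $\mathbf{Pr}(X_i=0)=1-p$, and $$\eta_n=\frac{\sum_{i=1}^n(X_i-p)}{\sqrt{np(1-p)}}$$ is the normalized sum (defined for $0<p<1$), so that $\mathbf{Pr}(|\eta_n|>t)=\mathbf{Pr}\left(\left|\frac1n\sum_{i=1}^nX_i-p\right|>t_n\right)$. The function $\varphi$ is $$\varphi(n,\varepsilon):=\frac{\frac{n\varepsilon(1+\varepsilon^2)}{n\varepsilon-1}+\varepsilon\left(2+6\varepsilon+\frac{9}{2n}\right)}{(1+\varepsilon^2)\left(1+\varepsilon^2+\frac1n\left(1+3\varepsilon+\frac{9}{4n}\right)\right)}$$ (defined when $n\varepsilon\ne1$). The three expressions are the paper's upper bounds for $\mathbf{Pr}\left(\left|\frac1n\sum_{i=1}^nX_i-p\right|>\varepsilon\right)$ in its classical Bernoulli, general discrete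 and continuous settings, respectively. *)

(* Defs.v *)
From HB Require Import structures.
From mathcomp Require Import all_boot all_order all_algebra.
From mathcomp Require Import all_classical all_reals all_analysis.

Set Implicit Arguments.
Unset Strict Implicit.
Unset Printing Implicit Defensive.

Import Order.TTheory GRing.Theory Num.Theory.
Import numFieldNormedType.Exports.

Local Open Scope ring_scope.

(* In all three bounds n is the number of trials and e the deviation of the
   empirical mean of X_1, ..., X_n from p. *)

Definition classical_bound (R : realType) (n : nat) (e : R) : R :=
  expR (- (2 * e ^+ 2 * n%:R)).

Definition discrete_bound (R : realType) (n : nat) (e : R) : R :=
  expR (- (2 * e ^+ 2 * n%:R / (1 + e ^+ 2))).

(* Meaningful for n > 0 and n * e <> 1 only: elsewhere the value comes from the
   convention x / 0 = 0. *)
Definition varphi (R : realType) (n : nat) (e : R) : R :=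
  (n%:R * e * (1 + e ^+ 2) / (n%:R * e - 1)
     + e * (2 + 6 * e + 9 / (2 * n%:R)))
  / ((1 + e ^+ 2)
     * (1 + e ^+ 2 + 1 / n%:R * (1 + 3 * e + 9 / (4 * n%:R)))).

Definition continuous_bound (R : realType) (n : nat) (e : R) : R :=
  expR (e * varphi n e - 2 * e ^+ 2 * n%:R / (1 + e ^+ 2)).

(* Since n * t_n = t * sqrt (n * p * (1 - p)), the condition n * t_n <> 1 fails
   for at most one n, so the convention in varphi has no effect on limits. *)
Definition deviation (R : realType) (t p : R) (n : nat) : R :=
  t * Num.sqrt (p * (1 - p) / n%:R).

(* Main.v *)
Require Import Defs.
From HB Require Import structures.
From mathcomp Require Import all_boot all_order all_algebra.
From mathcomp Require Import all_classical all_reals all_analysis.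
From mathcomp Require Import ring.

Set Implicit Arguments.
Unset Strict Implicit.
Unset Printing Implicit Defensive.

Import Order.TTheory GRing.Theory Num.Theory.
Import numFieldNormedType.Exports.

Local Open Scope classical_set_scope.
Local Open Scope ring_scope.

(** Everything rests on one identity: with v = t^2 p (1 - p), the deviation
    e = t_n satisfies n e^2 = v for every n > 0, while e tends to 0
    ([natr_mul_deviation_sqr], [deviation_cvg0]).  The exponents of the first
    two bounds are therefore -2v and -2v / (1 + e^2) for n > 0, and both tend
    to -2v.

    The third exponent differs from the second one by e * varphi n e, and only
    the summand n e (1 + e^2) / (n e - 1) of the numerator of varphi has no
    evident limit.  If v > 0, the same identity gives n e = v / e, so that e
    times this summand equals e (1 + e^2) / (1 - e / v), which tends to 0 with
    e; if v = 0, then e = 0 ([varphi_singular_term]).  The other summand times e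
    tends to 0 as well, and the denominator of varphi tends to 1, so all three
    exponents tend to -2v.

    Continuity of the exponential gives the three limits.  The common limit is
    positive, and functions with a common nonzero limit are asymptotically
    equivalent ([cvg_same_equiv]). *)

(** Near F the norm of g exceeds |l| / 2, so an error that tends to 0 is
    negligible against g. *)
Lemma cvg_same_equiv (R : realType) (T : Type) (F : filter_on T)
    (f g : T -> R) (l : R) :
  l != 0 -> f x @[x --> F] --> l -> g x @[x --> F] --> l -> f ~_F g.
Proof.
move=> l0 fl gl; apply/eqaddoP => eps eps0.
have l2 : `|l| / 2 < `|l| by rewrite gtr_pMr ?normr_gt0// invf_lt1// ltr1n.
have eps' : 0 < eps * (`|l| / 2) by rewrite !mulr_gt0 ?normr_gt0// invr_gt0.
have fg0 : (f - g) x @[x --> F] --> (0 : R) by rewrite -(subrr l); exact: cvgB.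
near=> x.
apply: (@le_trans _ _ (eps * (`|l| / 2))).
  near: x; move/cvgr0Pnorm_le : fg0; exact.
rewrite ler_wpM2l ?(ltW eps0)//; apply: ltW.
by near: x; exact: (cvgr_norm_gt l gl).
Unshelve. all: by end_near. Qed.

Lemma cvg_invn (R : realType) : (n%:R^-1 : R) @[n --> \oo] --> (0 : R).
Proof. by rewrite -(cvg_shiftS (fun n => n%:R^-1 : R)); exact: cvg_harmonic. Qed.

Section deviation.
Variables (R : realType) (t p : R).
Hypothesis hp : 0 <= p <= 1.

Local Notation e := (deviation t p).
Local Notation v := (t ^+ 2 * (p * (1 - p))).

Lemma natr_mul_deviation_sqr (n : nat) : (0 < n)%N -> n%:R * e n ^+ 2 = v.
Proof.
case/andP: hp => p0 p1 n0; have n0' : (n%:R : R) != 0 by rewrite pnatr_eq0 -lt0n.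
rewrite /deviation exprMn sqr_sqrtr; first by field.
by rewrite !mulr_ge0 ?subr_ge0 ?invr_ge0.
Qed.

Lemma deviation_cvg0 : e n @[n --> \oo] --> (0 : R).
Proof.
rewrite -(mulr0 t); apply: cvgM; first exact: cvg_cst.
rewrite -[X in _ --> X]sqrtr0; apply: cvg_comp; last exact: sqrt_continuous.
by rewrite -(mulr0 (p * (1 - p))); apply: cvgM; [exact: cvg_cst|exact: cvg_invn].
Qed.

(** The right-hand side depends on n through e n only.  Since x / 0 = 0, the identity
    holds in the degenerate cases too: n e = 1 forces e = v, where both
    sides vanish, and v = 0 forces e = 0. *)
Lemma varphi_singular_term (n : nat) : (0 < n)%N ->
  e n * (n%:R * e n * (1 + e n ^+ 2) / (n%:R * e n - 1)) =
  e n * (1 + e n ^+ 2) / (1 - e n / v).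
Proof.
move=> n0; have := natr_mul_deviation_sqr n0.
have n0' : (n%:R : R) != 0 by rewrite pnatr_eq0 -lt0n.
move: (e n) n%:R n0' => x m m0 <-.
have [->|x0] := eqVneq x 0; first by rewrite !mul0r.
have [mx1|mx1] := eqVneq (m * x) 1.
  have -> : m * x ^+ 2 = x by rewrite expr2 mulrA mx1 mul1r.
  by rewrite mx1 divff// !subrr invr0 !mulr0.
have mx0 : m * x - 1 != 0 by rewrite subr_eq0.
by field; rewrite mx0 x0 m0.
Qed.

Lemma deviation_sqr_cvg0 : e n ^+ 2 @[n --> \oo] --> (0 : R).
Proof. by rewrite -(mulr0 0); exact: cvgM deviation_cvg0 deviation_cvg0. Qed.

Lemma add1_deviation_sqr_cvg1 : 1 + e n ^+ 2 @[n --> \oo] --> (1 : R).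
Proof.
by rewrite -[X in _ --> X]addr0; apply: cvgD;
  [exact: cvg_cst|exact: deviation_sqr_cvg0].
Qed.

(** After [varphi_singular_term], the product is a rational function of e n and
    1 / n that is continuous at (0, 0) and vanishes there. *)
Lemma deviation_varphi_cvg0 : e n * varphi n (e n) @[n --> \oo] --> (0 : R).
Proof.
(* A and B come from the singular and the regular summand of varphi. *)
pose A n : R := e n * (1 + e n ^+ 2) / (1 - e n / v).
pose B n : R := e n * (e n * (2 + 6 * e n + 9 / 2 * n%:R^-1)).
pose D n : R := (1 + e n ^+ 2)
  * (1 + e n ^+ 2 + n%:R^-1 * (1 + 3 * e n + 9 / 4 * n%:R^-1)).
have AE : \forall n \near \oo, (A n + B n) / D n = e n * varphi n (e n).
  near=> n; have n0 : (0 < n)%N by near: n; exact: nbhs_infty_gt.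
  by rewrite /varphi mulrA mulrDr varphi_singular_term// /A /B /D !invfM !mulrA mul1r.
apply: cvg_trans (near_eq_cvg _) _; first exact: AE.
have const_cvg (c : R) : c @[_ --> \oo] --> c by exact: cvg_cst.
have e0 := deviation_cvg0; have n0 := @cvg_invn R.
have e1 := add1_deviation_sqr_cvg1.
have A0 : A n @[n --> \oo] --> (0 * 1 / (1 - 0 / v) : R).
  apply: cvgM; first exact: cvgM.
  apply: cvgV; first by rewrite mul0r subr0 oner_neq0.
  by apply: cvgB => //; exact: cvgM.
have B0 : B n @[n --> \oo] --> (0 * (0 * (2 + 6 * 0 + 9 / 2 * 0)) : R).
  apply: cvgM => //; apply: cvgM => //.
  by apply: cvgD; [apply: cvgD => //; exact: cvgM|exact: cvgM].
have D1 : D n @[n --> \oo] --> (1 * (1 + 0 * (1 + 3 * 0 + 9 / 4 * 0)) : R).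
  apply: cvgM => //; apply: cvgD => //; apply: cvgM => //.
  by apply: cvgD; [apply: cvgD => //; exact: cvgM|exact: cvgM].
have -> : (0 : R) = (0 * 1 / (1 - 0 / v) + 0 * (0 * (2 + 6 * 0 + 9 / 2 * 0)))
    / (1 * (1 + 0 * (1 + 3 * 0 + 9 / 4 * 0))) by rewrite !mul0r addr0 mul0r.
apply: cvgM; first exact: cvgD.
by apply: cvgV => //; rewrite mul0r addr0 mul1r oner_neq0.
Unshelve. all: by end_near. Qed.

Lemma classical_exponent_cvg :
  - (2 * e n ^+ 2 * n%:R) @[n --> \oo] --> - (2 * v).
Proof.
apply: cvg_near_cst; near=> n.
have n0 : (0 < n)%N by near: n; exact: nbhs_infty_gt.
by rewrite -mulrA [_ * n%:R]mulrC natr_mul_deviation_sqr.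
Unshelve. all: by end_near. Qed.

Lemma discrete_exponent_cvg :
  - (2 * e n ^+ 2 * n%:R / (1 + e n ^+ 2)) @[n --> \oo] --> - (2 * v).
Proof.
rewrite -(divr1 (2 * v)); apply: cvgN; apply: cvgM.
  by apply/cvgNP; exact: classical_exponent_cvg.
by apply: cvgV; [exact: oner_neq0|exact: add1_deviation_sqr_cvg1].
Qed.

Lemma continuous_exponent_cvg :
  e n * varphi n (e n) - 2 * e n ^+ 2 * n%:R / (1 + e n ^+ 2) @[n --> \oo]
    --> - (2 * v).
Proof.
rewrite -(add0r (- (2 * v))); apply: cvgD; first exact: deviation_varphi_cvg0.
exact: discrete_exponent_cvg.
Qed.

End deviation.

Theorem proposition3 (R : realType) (t p : R)
    (ht : 0 <= t <= 1) (hp : 0 <= p <= 1) :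
  let b1 : nat -> R := fun n => classical_bound n (deviation t p n) in
  let b2 : nat -> R := fun n => discrete_bound n (deviation t p n) in
  let b3 : nat -> R := fun n => continuous_bound n (deviation t p n) in
  let alpha : R := 1 in
  let l : R := alpha * expR (- (2 * t ^+ 2 * (p * (1 - p)))) in
  [/\ b1 ~_\oo b2, b2 ~_\oo b3 & b1 ~_\oo b3] /\
  [/\ b1 n @[n --> \oo] --> l,
      b2 n @[n --> \oo] --> l &
      b3 n @[n --> \oo] --> l].
Proof.
move=> b1 b2 b3 alpha l.
have lE : l = expR (- (2 * (t ^+ 2 * (p * (1 - p))))) by rewrite /l mul1r -mulrA.
have l0 : l != 0 by rewrite lE gt_eqF// expR_gt0.
have exp_cvg (u : nat -> R) :
    u n @[n --> \oo] --> - (2 * (t ^+ 2 * (p * (1 - p)))) ->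
    expR (u n) @[n --> \oo] --> l.
  by move=> ul; rewrite lE; apply: cvg_comp ul _; exact: continuous_expR.
have b1l : b1 n @[n --> \oo] --> l by exact/exp_cvg/classical_exponent_cvg.
have b2l : b2 n @[n --> \oo] --> l by exact/exp_cvg/discrete_exponent_cvg.
have b3l : b3 n @[n --> \oo] --> l by exact/exp_cvg/continuous_exponent_cvg.
by split; split=> //; exact: (cvg_same_equiv l0).
Qed.
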